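(* Let $n\ge2$, $\gamma\in\mathbb{R}$ and $n<p<+\infty$. There exists a constant $C>0$ such that, if $\omega\in C(\mathbb{R}^n_+\times\mathbb{R}^n_+,[0,+\infty))$ satisfies, for every $u\in C^\infty_c(\mathbb{R}^n_+)$ and almost every $x,y\in\mathbb{R}^n_+$, \[ |u(x)-u(y)|\le\omega(x,y)\Big(\int_{\mathbb{R}^n_+}|Du(z)|^pz_n^\gamma\,dz\Big)^{1/p}, \] then for all $x,y\in\mathbb{R}^n_+$, $\omega(x,y)\ge C\,\Theta^0_{1-\frac np,\,1-\frac{n+\gamma}{p}}(x,y)$.
   Context: $\mathbb{R}^n_+=\mathbb{R}^{n-1}\times(0,+\infty)$, points written $x=(x',x_n)$. For $\beta,\kappa\in\mathbb{R}$: $\Theta^0_{\beta,\kappa}(x,y)=\frac{|x-y|^\beta}{\min(x_n,y_n)^{-\kappa}\max(x_n,y_n,|x-y|)^\beta}$ if $\kappa<0$, and $\Theta^0_{\beta,\kappa}(x,y)=\frac{\max(x_n,y_n)^\kappa|x-y|^\beta}{\max(x_n,y_n,|x-y|)^\beta}$ if $\kappa\ge0$. *)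

(* Defs.v *)
From HB Require Import structures.
From mathcomp Require Import all_boot all_order all_algebra.
From mathcomp Require Import all_classical all_reals all_analysis.
Set Implicit Arguments.
Unset Strict Implicit.
Unset Printing Implicit Defensive.
Import Order.TTheory GRing.Theory Num.Theory.
Import numFieldNormedType.Exports.
Local Open Scope classical_set_scope.
Local Open Scope ring_scope.

Section Defs.
Variable R : realType.

(* last coordinate x_n of x in R^n (for n >= 1): the coordinate of index n-1 *)
Definition lastc n (x : 'rV[R]_n) : R := \sum_(i < n | (i : nat) == n.-1) x ord0 i.

Definition halfspace n : set 'rV[R]_n := [set x | 0 < lastc x].
Arguments halfspace n : clear implicits.

Definition enorm n (x : 'rV[R]_n) : R := Num.sqrt (\sum_i (x ord0 i) ^+ 2).

Definition ebasis n (i : 'I_n) : 'rV[R]_n := delta_mx 0 i.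

Definition ipartial n (s : seq 'I_n) (u : 'rV[R]_n -> R) : 'rV[R]_n -> R :=
  foldr (fun i g => fun x => 'D_(ebasis i) g x) u s.

Definition smooth n (u : 'rV[R]_n -> R) : Prop :=
  forall s : seq 'I_n,
    continuous (ipartial s u) /\
    (forall (i : 'I_n) (x : 'rV[R]_n), derivable (ipartial s u) x (ebasis i)).

(* C^infty_c(R^n_+): smooth, with support contained in a compact subset of R^n_+
   (u is identified with its extension by zero to R^n) *)
Definition Cc_inf_half n (u : 'rV[R]_n -> R) : Prop :=
  smooth u /\
  exists K : set 'rV[R]_n, compact K /\ K `<=` halfspace n /\
    (forall x, ~ K x -> u x = 0).

Definition gradnorm n (u : 'rV[R]_n -> R) (z : 'rV[R]_n) : R :=
  Num.sqrt (\sum_i ('D_(ebasis i) u z) ^+ 2).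

(* iterated Lebesgue integral over R^k of a function of k real variables
   (given as a list); by Tonelli this is the Lebesgue integral on R^k for
   nonnegative measurable integrands *)
Fixpoint iint (k : nat) (f : seq R -> \bar R) : \bar R :=
  if k is k'.+1 then
    (\int[@lebesgue_measure R]_t iint k' (fun s => f (t :: s)))%E
  else f [::].

Definition integralRn n (F : 'rV[R]_n -> \bar R) : \bar R :=
  iint n (fun s => F (\row_i nth 0 s i)).

Definition weighted_energy n (p gamma : R) (u : 'rV[R]_n -> R) : \bar R :=
  integralRn (fun z : 'rV[R]_n =>
    if 0 < lastc z then ((gradnorm u z `^ p) * (lastc z `^ gamma))%:E else 0%E).

Definition lebesgue_null m (A : set 'rV[R]_m) : Prop :=
  forall eps : R, 0 < eps ->
  exists a b : nat -> 'rV[R]_m,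
    (forall k i, a k ord0 i <= b k ord0 i) /\
    A `<=` \bigcup_k [set x | forall i, a k ord0 i <= x ord0 i <= b k ord0 i] /\
    (\sum_(0 <= k <oo) (\prod_i (b k ord0 i - a k ord0 i))%:E < eps%:E)%E.

Definition ae_pair_half n (P : 'rV[R]_n -> 'rV[R]_n -> Prop) : Prop :=
  lebesgue_null [set z : 'rV[R]_(n + n) |
    halfspace n (lsubmx z) /\ halfspace n (rsubmx z) /\ ~ P (lsubmx z) (rsubmx z)].

Definition Theta0 n (beta kappa : R) (x y : 'rV[R]_n) : R :=
  let d := enorm (x - y) in
  let M := Num.max (Num.max (lastc x) (lastc y)) d in
  if kappa < 0 then
    (d `^ beta) / ((Num.min (lastc x) (lastc y)) `^ (- kappa) * M `^ beta)
  else
    (Num.max (lastc x) (lastc y)) `^ kappa * d `^ beta / M `^ beta.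

End Defs.
Arguments halfspace {R} n.

(* Main.v *)
(* Test the hypothesis on a bump. Let [a] be the one of the two points with the
   smaller (if kappa < 0) or larger (if kappa >= 0) last coordinate [a_n], let
   d = |x - y| and r = min(d, a_n). A product bump centred at [a] and supported in a
   cube of half-side r / (2n) vanishes at the other point and has energy at most a
   constant times r^(n-p) a_n^gamma, since z_n is comparable to a_n on its support.
   The inequality holds everywhere by continuity, so omega(x, y) is bounded below by
   a constant times r^beta a_n^(-gamma/p) = a_n^kappa (r / a_n)^beta, where
   beta = 1 - n/p and kappa = 1 - (n + gamma)/p, and this dominates Theta0 because
   d / max(x_n, y_n, d) <= r / a_n. *)
Require Import Defs.
From HB Require Import structures.
From mathcomp Require Import all_boot all_order all_algebra.
From mathcomp Require Import all_classical all_reals all_analysis.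
From mathcomp Require Import measurable_realfun ring lra.
Import Order.TTheory GRing.Theory Num.Theory.
Import numFieldNormedType.Exports.
Local Open Scope classical_set_scope.
Local Open Scope ring_scope.

(** * A smooth bump on the line, with all its derivatives *)

Section Bump.
Variable R : realType.

(** Used at $x = 1/t$, where it lets $e^{-1/t}$ absorb any polynomial in $1/t$. *)
Lemma horner_le_expR (q : {poly R}) :
  exists2 C : R, 0 <= C & forall x, 0 <= x -> `|q.[x]| <= C * expR x.
Proof.
(* For $y = x/(k+1)$ one has $y^k \le e^{ky} \le e^{(k+1)y} = e^x$; dividing by $k+1$ rather than
   $k$ covers $k = 0$. *)
have expX k (x : R) : 0 <= x -> x ^+ k <= k.+1%:R ^+ k * expR x.
  move=> x0; set y := x / k.+1%:R.
  have -> : x = k.+1%:R * y by rewrite mulrC divfK ?pnatr_eq0.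
  have y0 : 0 <= y by rewrite divr_ge0.
  have ye : y <= expR y by rewrite (le_trans _ (expR_ge1Dx _))//; lra.
  rewrite exprMn ler_wpM2l ?exprn_ge0// mulrC expRM_natr.
  rewrite (le_trans (lerXn2r _ _ _ ye)) ?nnegrE ?expR_ge0//.
  by rewrite ler_weXn2l// -expR0 ler_expR.
exists (\sum_(i < size q) `|q`_i| * i.+1%:R ^+ i).
  by apply: sumr_ge0 => i _; rewrite mulr_ge0 ?exprn_ge0.
move=> x x0; rewrite horner_coef (le_trans (ler_norm_sum _ _ _))// mulr_suml.
apply: ler_sum => i _; rewrite normrM -mulrA ler_wpM2l// normrX ger0_norm//.
exact: expX.
Qed.

(** The classical $q(1/t)e^{-1/t}$ glued to zero; the polynomial parameter makes the family stable
    under differentiation. *)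
Definition flat (q : {poly R}) (t : R) : R :=
  if 0 < t then q.[t^-1] * expR (- t^-1) else 0.

Lemma flat_le0 q t : t <= 0 -> flat q t = 0.
Proof. by rewrite /flat ltNge => ->. Qed.

(** The exponential bound for $qX^2$, taken at $1/t$. Quadratic decay forces the derivative at 0 to
    vanish. *)
Lemma flat_quadratic q : exists2 C : R, 0 <= C & forall t, `|flat q t| <= C * t ^+ 2.
Proof.
have [C C0 HC] := horner_le_expR (q * 'X^2).
exists C => // t; rewrite /flat; case: ifPn => [t0|_]; last first.
  by rewrite normr0 mulr_ge0// sqr_ge0.
have := HC t^-1; rewrite invr_ge0 (ltW t0) => /(_ isT).
rewrite hornerM hornerXn !normrM (ger0_norm (expR_ge0 _)) expRN.
rewrite -ler_pdivrMr ?expR_gt0// => H.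
rewrite -ler_pdivrMr ?exprn_gt0//; apply: le_trans H.
by rewrite [`|t^-1|]ger0_norm ?invr_ge0 ?(ltW t0)// -expr2 exprVn mulrAC.
Qed.

Lemma is_derive_flat q (t : R) :
  is_derive t 1 (flat q) (flat ('X^2 * (q - q^`())) t).
Proof.
have [t0|t0|->] := ltgtP t 0.
- rewrite flat_le0 ?(ltW t0)//.
  apply: (@near_eq_is_derive _ _ _ (cst 0)).
  near=> s; rewrite flat_le0//; apply: ltW; near: s; exact: lt_nbhsl.
- rewrite /flat t0; pose g (s : R) : R := q.[s^-1] * expR (- s^-1).
  apply: (@near_eq_is_derive _ R R g).
    near=> s; have -> //: 0 < s by near: s; exact: lt_nbhsr.
  have dV : is_derive t 1 (fun s : R => s^-1) (- t ^- 2 *: 1).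
    by apply: is_deriveV; rewrite gt_eqF.
  have dq : is_derive t 1 (fun s => q.[s^-1]) (q^`().[t^-1] * (- t ^- 2 *: 1)).
    exact: (@is_derive1_comp _ (horner q) _ _ _ _ (is_derive_poly _ _) dV).
  have de : is_derive t 1 (fun s : R => expR (- s^-1))
                      (expR (- t^-1) * (- (- t ^- 2 *: 1))).
    exact: (@is_derive1_comp _ expR _ _ _ _ (is_derive_expR _) (is_deriveN dV)).
  apply: (is_derive_eq (is_deriveM dq de)).
  rewrite hornerM hornerXn hornerD hornerN -!exprVn /GRing.scale/=; ring.
(* At 0 the difference quotient is at most $C|h|$; requiring $|h| \le e/(C+1)$ also works when $C =
   0$. *)
- have [C C0 HC] := flat_quadratic q.
  rewrite (flat_le0 _ _ (lexx 0)).
  have H : h^-1 *: ((flat q \o shift 0) (h *: 1) - flat q 0) @[h --> 0^'] --> (0 : R).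
    apply/cvgrPdist_le => /= e e0; near=> h.
    have h0 : h != 0 by near: h; exact: nbhs_dnbhs_neq.
    rewrite (flat_le0 _ _ (lexx 0)) sub0r normrN subr0 /= addr0 normrM normfV.
    rewrite mulrC ler_pdivrMr ?normr_gt0//.
    have -> : h%:A = h :> R by exact: mulr1.
    apply: (le_trans (HC _)); rewrite -(real_normK (num_real h)) expr2 mulrA ler_wpM2r//.
    have : `|h| <= e / (C + 1).
      by apply: ltW; near: h; apply: dnbhs0_lt; rewrite divr_gt0// ltr_pwDr.
    rewrite ler_pdivlMr ?ltr_pwDr//; have := normr_ge0 h; nra.
  apply: DeriveDef; first by apply/cvg_ex; exists 0.
  exact: (cvg_lim (@norm_hausdorff _ _)).
Unshelve. all: by end_near. Qed.

(* Closed under differentiation, because [flat] is: this gives smoothness without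
   Leibniz's rule for higher derivatives. *)
Inductive flat_algebra : (R -> R) -> Prop :=
| flat_algebraM q r : flat_algebra (fun t => flat q (1 + t) * flat r (1 - t))
| flat_algebraD f g : flat_algebra f -> flat_algebra g ->
    flat_algebra (fun t => f t + g t).

Lemma flat_algebra_derive f : flat_algebra f ->
  exists2 f', flat_algebra f' & forall t : R, is_derive t 1 f (f' t).
Proof.
elim => [q r|{}f g _ [f' Sf' df] _ [g' Sg' dg]]; last first.
  exists (fun t => f' t + g' t); first exact: flat_algebraD.
  by move=> t; exact: (is_deriveD (df t) (dg t)).
pose D q : {poly R} := 'X^2 * (q - q^`()).
(* Product rule; the minus sign coming from $1-t$ is moved into the polynomial, in which [flat] is
   linear. *)
exists (fun t => flat (D q) (1 + t) * flat r (1 - t) +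
                 flat q (1 + t) * flat (- D r) (1 - t)).
  by apply: flat_algebraD; apply: flat_algebraM.
move=> t.
have dp : is_derive t 1 (fun s => flat q (1 + s)) (flat (D q) (1 + t) * (0 + 1)).
  have d1 : is_derive t 1 (fun s : R => 1 + s) (0 + 1).
    exact: (is_deriveD (is_derive_cst _ _ _) (is_derive_id _ _)).
  apply: (@is_derive1_comp _ (flat q) (fun s => 1 + s)).
  exact: is_derive_flat.
have dm : is_derive t 1 (fun s => flat r (1 - s)) (flat (D r) (1 - t) * (0 - 1)).
  have d1 : is_derive t 1 (fun s : R => 1 - s) (0 - 1).
    exact: (is_deriveB (is_derive_cst _ _ _) (is_derive_id _ _)).
  apply: (@is_derive1_comp _ (flat r) (fun s => 1 - s)).
  exact: is_derive_flat.
apply: (is_derive_eq (is_deriveM dp dm)).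
have -> : flat (- D r) (1 - t) = - flat (D r) (1 - t).
  by rewrite /flat; case: ifP => _; rewrite ?oppr0// hornerN mulNr.
rewrite /GRing.scale/=; ring.
Qed.

Lemma flat_algebra_supp f t : flat_algebra f -> 1 <= `|t| -> f t = 0.
Proof.
move=> Sf t1; elim: Sf => [q r|{}f g _ -> _ ->]; last by rewrite addr0.
move: t1; rewrite ler_normr => /orP[t1|t1].
  by rewrite [flat r _]flat_le0 ?mulr0// subr_le0.
by rewrite flat_le0 ?mul0r// -lerBrDl sub0r lerNr.
Qed.

Lemma is_derive1_continuous (f g : R -> R) :
  (forall t : R, is_derive t 1 f (g t)) -> continuous f.
Proof.
by move=> df t; apply: differentiable_continuous; apply/derivable1_diffP; case: (df t).
Qed.

Lemma continuous_supp_bounded (f : R -> R) :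
  continuous f -> (forall t, 1 <= `|t| -> f t = 0) -> exists B : R, forall t, `|f t| <= B.
Proof.
move=> cf f0.
have [c _ Hc] : exists2 c, c \in `[-1, 1] & forall t, t \in `[-1, 1] -> `|f t| <= `|f c|.
  apply: (@EVT_max _ (fun t => `|f t|)); first by lra.
  apply: continuous_subspaceT => t; apply: continuous_comp; first exact: cf.
  exact: norm_continuous.
exists `|f c| => t; have [t1|t1] := leP `|t| 1.
  by apply: Hc; rewrite in_itv/= -ler_norml.
by rewrite f0 ?normr0// ltW.
Qed.

(** [F k] is the [k]-th derivative of the bump [F 0]. The whole sequence is kept because partial
    derivatives of a product bump are, up to scaling, products of the [F k]. *)
Lemma exists_bump : exists F : nat -> R -> R,
  [/\ forall k (t : R), is_derive t 1 (F k) (F k.+1 t),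
      forall k t, 1 <= `|t| -> F k t = 0,
      0 < F 0 0 & forall k, exists B : R, forall t, `|F k t| <= B].
Proof.
pose f t := flat 1 (1 + t) * flat 1 (1 - t).
pose F k := iter k (fun g : R -> R => g^`()%classic) f.
have SF k : flat_algebra (F k).
  elim: k => [|k IH]; first exact: flat_algebraM.
  rewrite /F /=; have [g Sg dg] := flat_algebra_derive _ IH.
  suff -> : (iter k (fun g : R -> R => g^`()%classic) f)^`()%classic = g by [].
  by apply/funext => t; rewrite derive1E; case: (dg t).
have dF k (t : R) : is_derive t 1 (F k) (F k.+1 t).
  have [g _ dg] := flat_algebra_derive _ (SF k).
  by rewrite /F iterS derive1E; case: (dg t) => d e; apply: DeriveDef.
have sF k t : 1 <= `|t| -> F k t = 0 by exact: flat_algebra_supp.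
exists F; split => //.
  by rewrite /F /= /f /flat addr0 subr0 ltr01 !hornerC !mul1r mulr_gt0 ?expR_gt0.
move=> k; apply: continuous_supp_bounded (sF k).
exact: is_derive1_continuous (dF k).
Qed.

End Bump.

(** * Integrals over boxes and Lebesgue null sets *)

Section Boxes.
Variable R : realType.

Local Notation mu := (@lebesgue_measure R).

Lemma measurable_itv_indic (c a b : R) :
  measurable_fun [set: R] (fun t => (c * \1_(`[a, b]%classic) t)%:E).
Proof.
by apply/measurable_EFinP; apply: measurable_funM.
Qed.

Lemma integral_itv_indic (c a b : R) : 0 <= c -> a <= b ->
  (\int[mu]_t (c * \1_(`[a, b]%classic) t)%:E)%E = (c * (b - a))%:E.
Proof.
move=> c0 ab; under eq_integral do rewrite EFinM.
rewrite ge0_integralZl_EFin//; last by apply/measurable_EFinP.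
rewrite integral_indic// setIT /= lebesgue_measure_itv/= lte_fin EFinM.
by move: ab; rewrite le_eqVlt => /predU1P[->|->//]; rewrite ltxx subrr.
Qed.

(** The integral is a supremum over simple functions below the integrand, so the comparison applies
    to slices of arbitrary nonnegative functions. *)
Lemma ge0_le_integralT (f g : R -> \bar R) :
  (forall t, 0 <= f t)%E -> (forall t, f t <= g t)%E ->
  (\int[mu]_t f t <= \int[mu]_t g t)%E.
Proof.
move=> f0 fg; have g0 t : (0 <= g t)%E by apply: le_trans (fg t).
rewrite !ge0_integralTE//; apply: le_ereal_sup => _ [h hf <-]; exists h => //= t.
exact: le_trans (fg t).
Qed.

(* Integrating out one coordinate at a time: the induction replaces the weight
   [c j] by [c j] times the indicator of the first side of the [j]-th box. *)
Lemma box_cover k (c : nat -> R) (A B : nat -> 'I_k -> R)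
    (c0 : R) (A0 B0 : 'I_k -> R) :
  (forall j, 0 <= c j) -> 0 <= c0 ->
  (forall j i, A j i <= B j i) -> (forall i, A0 i <= B0 i) ->
  (forall x : 'I_k -> R,
    ((c0 * \prod_i \1_(`[A0 i, B0 i]%classic) (x i))%:E <=
     \sum_(0 <= j <oo) (c j * \prod_i \1_(`[A j i, B j i]%classic) (x i))%:E)%E) ->
  ((c0 * \prod_i (B0 i - A0 i))%:E <=
   \sum_(0 <= j <oo) (c j * \prod_i (B j i - A j i))%:E)%E.
Proof.
elim: k c A B c0 A0 B0 => [|k IH] c A B c0 A0 B0 cj_ge0 c0_ge0 AB A0B0 H.
  have := H (fun=> 0); rewrite !big_ord0.
  by under eq_eseriesr do rewrite big_ord0;
     under [in X in _ -> X]eq_eseriesr do rewrite big_ord0.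
pose w j := \prod_i (B j (lift ord0 i) - A j (lift ord0 i)).
pose w0 := \prod_i (B0 (lift ord0 i) - A0 (lift ord0 i)).
have w_ge0 j : 0 <= w j by apply: prodr_ge0 => i _; rewrite subr_ge0.
have w0_ge0 : 0 <= w0 by apply: prodr_ge0 => i _; rewrite subr_ge0.
have slice (t : R) :
    ((c0 * w0 * \1_(`[A0 ord0, B0 ord0]%classic) t)%:E <=
     \sum_(0 <= j <oo) (c j * w j * \1_(`[A j ord0, B j ord0]%classic) t)%:E)%E.
  rewrite mulrAC; under eq_eseriesr do rewrite mulrAC.
  have indic_ge0 (D : set R) : 0 <= \1_D t :> R by rewrite indicE.
  apply: IH => [j||j i|i|x] //; [exact: mulr_ge0|exact: mulr_ge0|].
  pose y i := if unlift ord0 i is Some i' then x i' else t.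
  have y0 : y ord0 = t by rewrite /y unlift_none.
  have yl i : y (lift ord0 i) = x i by rewrite /y liftK.
  have prod_y (a b : 'I_k.+1 -> R) : \prod_i \1_(`[a i, b i]%classic) (y i) =
      \1_(`[a ord0, b ord0]%classic) t *
      \prod_i \1_(`[a (lift ord0 i), b (lift ord0 i)]%classic) (x i) :> R.
    by rewrite big_ord_recl y0; congr (_ * _); apply: eq_bigr => i _; rewrite yl.
  have := H y; rewrite prod_y mulrA.
  by under eq_eseriesr => j _ do rewrite prod_y mulrA.
rewrite big_ord_recl mulrA mulrAC -integral_itv_indic ?mulr_ge0//.
under eq_eseriesr => j _.
  rewrite big_ord_recl mulrA mulrAC -integral_itv_indic ?mulr_ge0//; last exact: w_ge0.
  over.
rewrite /=.
(* Monotone convergence moves the sum under the integral in the first coordinate; [slice] then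
   compares the integrands. *)
rewrite -integral_nneseries//.
- apply: ge0_le_integralT => [t|t]; first by rewrite lee_fin mulr_ge0 ?mulr_ge0 ?indicE.
  exact: slice.
- by move=> j; exact: measurable_itv_indic.
- by move=> j t _; rewrite lee_fin mulr_ge0 ?mulr_ge0 ?w_ge0 ?indicE//; exact: w_ge0.
Qed.

Lemma prod_indic_itv k (A B x : 'I_k -> R) :
  \prod_i \1_(`[A i, B i]%classic) (x i) = ([forall i, A i <= x i <= B i])%:R :> R.
Proof.
have [/forallP H|/forallPn[i Hi]] := boolP [forall i, A i <= x i <= B i].
  by rewrite big1// => i _; rewrite indicE mem_set//= in_itv/= H.
by rewrite (bigD1 i)//= indicE memNset ?mul0r//= in_itv/=; exact/negP.
Qed.

(** By [box_cover] with unit weights, any countable cover by boxes has total volume at least that of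
    the given box. Taking [eps] equal to that volume contradicts nullity. *)
Lemma box_not_null m (A0 B0 : 'rV[R]_m) (N : set 'rV[R]_m) :
  (forall i, A0 ord0 i < B0 ord0 i) ->
  [set x : 'rV[R]_m | forall i, A0 ord0 i <= x ord0 i <= B0 ord0 i] `<=` N ->
  ~ lebesgue_null N.
Proof.
move=> A0B0 sub nullN.
have v0 : 0 < \prod_i (B0 ord0 i - A0 ord0 i).
  by apply: prodr_gt0 => i _; rewrite subr_gt0.
have [a [b [ab [cov]]]] := nullN _ v0; apply/negP; rewrite -leNgt.
have AB0 i : A0 ord0 i <= B0 ord0 i by exact: ltW.
have := @box_cover m (fun=> 1) (fun j => a j ord0) (fun j => b j ord0)
  1 (A0 ord0) (B0 ord0) (fun=> ler01) ler01 ab AB0.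
rewrite mul1r; under [X in _ -> (_ <= X)%E]eq_eseriesr => j _ do rewrite mul1r.
apply=> x; rewrite mul1r prod_indic_itv.
have term_ge0 j : (0 <= (1 * \prod_i \1_(`[a j ord0 i, b j ord0 i]%classic) (x i))%:E :> \bar R)%E.
  by rewrite mul1r prod_indic_itv lee_fin.
case: forallP => Hx; last exact: nneseries_ge0.
have /sub/cov[j _ /= Hj] :
    [set x : 'rV[R]_m | forall i, A0 ord0 i <= x ord0 i <= B0 ord0 i] (\row_i x i).
  by move=> i; rewrite mxE.
(* The partial sum through index [j] already reaches 1, since the [j]-th box contains the point. *)
apply: (le_trans _ (nneseries_lim_ge j.+1 _)) => //.
rewrite big_nat_recr//= mul1r prod_indic_itv.
have -> : [forall i, a j ord0 i <= x i <= b j ord0 i].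
  by apply/forallP => i; have := Hj i; rewrite mxE.
by rewrite leeDr// sume_ge0.
Qed.

Lemma iint_ge0 k (f : seq R -> \bar R) : (forall s, 0 <= f s)%E -> (0 <= iint k f)%E.
Proof.
by elim: k f => [|k IH] f f0 //=; apply: integral_ge0 => t _; apply: IH.
Qed.

Lemma le_iint k (f g : seq R -> \bar R) :
  (forall s, 0 <= f s)%E -> (forall s, f s <= g s)%E -> (iint k f <= iint k g)%E.
Proof.
elim: k f g => [|k IH] f g f0 fg //=.
by apply: ge0_le_integralT => t; [exact: iint_ge0|exact: IH].
Qed.

(** The factor [c] is arbitrary so that the induction can absorb the indicator of the first side
    into it. *)
Lemma iint_box k (c : R) (A B : 'I_k -> R) : 0 <= c -> (forall i, A i <= B i) ->
  iint k (fun s => (c * \prod_i \1_(`[A i, B i]%classic) (nth 0 s i))%:E) =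
  (c * \prod_i (B i - A i))%:E.
Proof.
elim: k c A B => [|k IH] c A B c0 AB /=; first by rewrite !big_ord0.
under eq_integral => t _.
  under [X in iint k X]eq_fun do rewrite big_ord_recl/= mulrA.
  rewrite (IH _ (fun i => A (lift ord0 i)) (fun i => B (lift ord0 i))) ?mulr_ge0 ?indicE//.
  rewrite -indicE mulrAC.
  over.
rewrite integral_itv_indic ?mulr_ge0//; last first.
  by apply: prodr_ge0 => i _; rewrite subr_ge0.
by rewrite big_ord_recl mulrAC mulrA.
Qed.

End Boxes.

(** * Product functions and their partial derivatives *)

Section Tensor.
Variables (R : realType) (n : nat) (G : 'I_n -> nat -> R -> R).
Hypothesis dG : forall j k (t : R), is_derive t 1 (G j k) (G j k.+1 t).

(** [al] is a multi-index: as [G j k] is the [k]-th derivative of the [j]-th factor, this is the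
    partial derivative of order [al] of the product of the [G j 0]. *)
Definition tensor (al : 'I_n -> nat) (x : 'rV[R]_n) : R :=
  \prod_j G j (al j) (x ord0 j).

Lemma is_derive_tensor al i x :
  is_derive x (ebasis R i) (tensor al) (tensor (fun j => al j + (j == i))%N x).
Proof.
have [dGi eGi] := dG i (al i) (x ord0 i).
pose P := \prod_(j | j != i) G j (al j) (x ord0 j).
have -> : tensor (fun j => al j + (j == i))%N x = P * G i (al i).+1 (x ord0 i).
  rewrite /tensor (bigD1 i)//= eqxx addn1 mulrC; congr (_ * _).
  by apply: eq_bigr => j /negPf ->; rewrite addn0.
(* Along the [i]-th axis only the [i]-th factor varies, so the quotient is a one-variable quotient
   times the constant [P]. *)
have quotient h : h^-1 *: ((tensor al \o shift x) (h *: ebasis R i) - tensor al x) =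
    P * (h^-1 *: ((G i (al i) \o shift (x ord0 i)) (h *: 1) - G i (al i) (x ord0 i))).
  rewrite /tensor /= (bigD1 i)//= [X in _ - X](bigD1 i)//= !mxE !eqxx mulr1.
  rewrite (eq_bigr (fun j => G j (al j) (x ord0 j))); last first.
    by move=> j /negPf ji; rewrite !mxE eqxx ji mulr0 add0r.
  by rewrite -/P /GRing.scale/= mulr1; ring.
have lim_q : h^-1 *: ((tensor al \o shift x) (h *: ebasis R i) - tensor al x)
    @[h --> 0^'] --> P * G i (al i).+1 (x ord0 i).
  under eq_fun do rewrite quotient.
  by rewrite -eGi; apply: cvgM; [exact: cvg_cst|exact: dGi].
apply: DeriveDef; first by apply/cvg_ex; eexists; exact: lim_q.
exact: (cvg_lim (@norm_hausdorff _ _)).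
Qed.

Lemma continuous_tensor al : continuous (tensor al).
Proof.
rewrite /tensor; elim: (index_enum _) => [|j s IH].
  rewrite (_ : (fun _ => _) = cst 1); first by move=> x; exact: cst_continuous.
  by apply/funext => x; rewrite big_nil.
rewrite (_ : (fun _ => _) = (fun x : 'rV[R]_n => G j (al j) (x ord0 j)) \*
  (fun x : 'rV[R]_n => \prod_(j <- s) G j (al j) (x ord0 j))); last first.
  by apply/funext => x; rewrite big_cons.
move=> x; apply: continuousM; last exact: IH.
apply: continuous_comp; first exact: coord_continuous.
exact: is_derive1_continuous (dG j (al j)) _.
Qed.

(** Each iterated partial derivative is again a tensor, the order in [j] growing by the number of
    occurrences of [j] in the list. *)
Lemma smooth_tensor al : smooth (tensor al).
Proof.
have ipartialE s : ipartial s (tensor al) = tensor (fun j => al j + count_mem j s)%N.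
  elim: s => [|i s IH].
    by congr tensor; apply/funext => j; rewrite addn0.
  apply/funext => x; rewrite [LHS]/= IH (@derive_val _ _ _ _ _ _ _ (is_derive_tensor _ i x)).
  congr tensor; apply/funext => j /=.
  by rewrite addnAC -addnA [i == j]eq_sym.
move=> s; rewrite ipartialE; split=> [|i x]; first exact: continuous_tensor.
by case: (is_derive_tensor (fun j => al j + count_mem j s)%N i x).
Qed.

End Tensor.
Arguments tensor {R n}.
Arguments is_derive_tensor {R n G}.
Arguments smooth_tensor {R n G}.

(** * Scaled product bumps and their weighted energy *)

Lemma powR_doubling (R : realType) (g a w : R) :
  0 < a -> a / 2 <= w <= 2 * a -> w `^ g <= 2 `^ `|g| * a `^ g.
Proof.
move=> a0 /andP[aw wa]; have w0 : 0 < w by lra.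
(* In logarithms: $g(\ln w - \ln a) \le |g| \ln 2$, whatever the sign of $g$. *)
rewrite /powR !gt_eqF// -expRD ler_expR -lerBlDr -mulrBr.
rewrite (le_trans (ler_norm _))// normrM ler_wpM2l// -ln_div ?posrE// ler_norml.
rewrite -lnV ?posrE// !ler_ln ?posrE ?divr_gt0 ?invr_gt0//.
by rewrite ler_pdivrMr// ler_pdivlMr//; apply/andP; split; lra.
Qed.

Lemma lastc_coord (R : realType) (n : nat) : (0 < n)%N ->
  exists i : 'I_n, forall x : 'rV[R]_n, lastc x = x ord0 i.
Proof.
case: n => // n _; exists ord_max => x.
by rewrite /lastc (big_pred1 ord_max).
Qed.

Section ScaledBump.
Variables (R : realType) (F : nat -> R -> R) (B : R).
Hypothesis dF : forall k (t : R), is_derive t 1 (F k) (F k.+1 t).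
Hypothesis F_supp : forall k t, 1 <= `|t| -> F k t = 0.
Hypothesis B1 : 1 <= B.
Hypothesis F0B : forall t, `|F 0 t| <= B.
Hypothesis F1B : forall t, `|F 1 t| <= B.

Variables (n : nat) (a : 'rV[R]_n) (rho : R).
Hypothesis rho0 : 0 < rho.

(** The [k]-th derivative of the bump rescaled to centre $a_j$ and half-width [rho]; the power of
    [rho] is the chain rule factor. *)
Definition scaled (j : 'I_n) (k : nat) (t : R) : R :=
  rho^-1 ^+ k * F k ((t - a ord0 j) / rho).

Definition bumpn := tensor scaled (fun=> 0%N).

Lemma is_derive_scaled j k (t : R) :
  is_derive t 1 (scaled j k) (scaled j k.+1 t).
Proof.
have dl : is_derive t 1 (fun s : R => (s - a ord0 j) * rho^-1) rho^-1.
  have db := is_deriveB (is_derive_id t (1 : R)) (is_derive_cst (a ord0 j) t (1 : R)).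
  apply: (is_derive_eq (is_deriveM db (is_derive_cst rho^-1 t (1 : R)))).
  by rewrite /GRing.scale/= mulr0 add0r subr0 mulr1.
have dc : is_derive t 1 (fun s : R => F k ((s - a ord0 j) / rho))
    (F k.+1 ((t - a ord0 j) / rho) * rho^-1).
  exact: (@is_derive1_comp _ (F k) (fun s => (s - a ord0 j) / rho) t _ _ (dF _ _) dl).
apply: (is_derive_eq (is_deriveM (is_derive_cst (rho^-1 ^+ k) t (1 : R)) dc)).
by rewrite /scaled /GRing.scale/= mulr0 addr0 exprSr; ring.
Qed.

(** Stated for every multi-index, to serve both the bump and its partial derivatives. *)
Lemma tensor_scaled_eq0 al (x : 'rV[R]_n) j :
  rho <= `|x ord0 j - a ord0 j| -> tensor scaled al x = 0.
Proof.
move=> xj; rewrite /tensor (bigD1 j)//= /scaled F_supp ?mulr0 ?mul0r//.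
by rewrite normrM normfV (gtr0_norm rho0) ler_pdivlMr// mul1r.
Qed.

Lemma derive_bumpn i x :
  'D_(ebasis R i) bumpn x = tensor scaled (fun j => (j == i) : nat) x.
Proof.
exact: (@derive_val _ _ _ _ _ _ _ (is_derive_tensor is_derive_scaled (fun=> 0%N) i x)).
Qed.

Lemma norm_derive_bumpn i x : `|'D_(ebasis R i) bumpn x| <= B ^+ n / rho.
Proof.
rewrite derive_bumpn /tensor normr_prod.
(* Each of the [n] factors costs [B]; only the differentiated one brings $1/\rho$. *)
have -> : B ^+ n / rho = \prod_(j < n) (B * rho^-1 ^+ (j == i)).
  rewrite big_split/= prodr_const card_ord; congr (_ * _).
  rewrite (bigD1 i)//= eqxx expr1 big1 ?mulr1// => j /negPf ->; exact: expr0.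
apply: ler_prod => j _; rewrite normr_ge0/= /scaled normrM.
have r0 : 0 <= rho^-1 ^+ (j == i) by rewrite exprn_ge0// invr_ge0 ltW.
by rewrite (ger0_norm r0) mulrC ler_wpM2r//; case: (j == i).
Qed.

(** The sharp factor $\sqrt n$ is relaxed to $n$, using $n \le n^2$ under the root. *)
Lemma gradnorm_bumpn x : gradnorm bumpn x <= n%:R * (B ^+ n / rho).
Proof.
have c0 : 0 <= B ^+ n / rho.
  by rewrite divr_ge0 ?(ltW rho0)// exprn_ge0// (le_trans ler01).
have X0 : 0 <= n%:R * (B ^+ n / rho) by rewrite mulr_ge0.
rewrite /gradnorm -(ger0_norm X0) -sqrtr_sqr ler_wsqrtr//.
rewrite exprMn; apply: (@le_trans _ _ (\sum_(i < n) (B ^+ n / rho) ^+ 2)).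
  apply: ler_sum => i _; have := norm_derive_bumpn i x; move: ('D__ _ _) => d dB.
  by rewrite -(real_normK (num_real d)) lerXn2r ?nnegrE ?normr_ge0.
rewrite sumr_const card_ord -[leLHS]mulr_natl ler_wpM2r ?sqr_ge0//.
by rewrite -natrX ler_nat; case: (n) => // m; rewrite expnS expn1 leq_pmulr.
Qed.

Lemma bumpn_center : bumpn a = F 0 0 ^+ n.
Proof.
rewrite /bumpn /tensor /scaled.
under eq_bigr do rewrite subrr mul0r expr0 mul1r.
by rewrite prodr_const card_ord.
Qed.

Lemma Cc_inf_half_bumpn : (0 < n)%N -> rho <= lastc a / 2 -> Cc_inf_half bumpn.
Proof.
move=> n0 rhoa; split; first exact: smooth_tensor is_derive_scaled _.
have [i0 lastE] := lastc_coord R n n0.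
(* The closed cube of half-side [rho] stays in the half-space, since there $x_n \ge a_n - \rho \ge
   a_n/2$. *)
exists [set x : 'rV[R]_n | forall i, `[a ord0 i - rho, a ord0 i + rho]%classic (x ord0 i)].
split.
  by apply: (@rV_compact R n (fun i => `[a ord0 i - rho, a ord0 i + rho]%classic)) => i;
    exact: segment_compact.
split=> [x /(_ i0)|x Kx].
  rewrite /halfspace/= in_itv/= => /andP[ax _].
  have {}ax : lastc a - rho <= lastc x by rewrite !lastE.
  have ? := rho0; lra.
have /existsNP[i Hi] := Kx.
apply: (@tensor_scaled_eq0 _ _ i); rewrite leNgt; apply/negP => /ltW H; apply: Hi.
by rewrite /= in_itv/=; move: H; rewrite ler_distl.
Qed.

(** The integrand is at most a constant times the indicator of the cube: inside, $a_n/2 \le z_n \le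
    2a_n$ controls the weight; outside, the gradient vanishes. *)
Lemma weighted_energy_bumpn (p gamma : R) : (0 < n)%N -> 0 < p -> rho <= lastc a / 2 ->
  (weighted_energy p gamma bumpn <=
   ((n%:R * (B ^+ n / rho)) `^ p * (2 `^ `|gamma| * lastc a `^ gamma)
     * (2 * rho) ^+ n)%:E)%E.
Proof.
move=> n0 p0 rhoa; set c := (_ * (_ * _)).
have [i0 lastE] := lastc_coord R n n0.
have c0 : 0 <= c by rewrite !mulr_ge0 ?powR_ge0.
have -> : (2 * rho) ^+ n = \prod_(i < n) ((a ord0 i + rho) - (a ord0 i - rho)).
  rewrite (eq_bigr (fun=> 2 * rho)) ?prodr_const ?card_ord// => i _; ring.
rewrite -iint_box//; last by move=> i; have ? := rho0; lra.
apply: le_iint => s; first by case: ifP => // _; rewrite lee_fin mulr_ge0 ?powR_ge0.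
rewrite (prod_indic_itv _ _ _ _ (fun i => nth 0 s i)).
set z := \row_i nth 0 s i.
case: ifPn => [z0|_]; last by rewrite lee_fin mulr_ge0.
rewrite lee_fin; case: forallP => [H|/existsNP[i Hi]].
  rewrite mulr1 ler_pM ?powR_ge0//.
    have g0 : 0 <= gradnorm bumpn z by exact: sqrtr_ge0.
    have gB := gradnorm_bumpn z.
    by apply: ge0_ler_powR (gradnorm_bumpn z); rewrite ?nnegrE ?(ltW p0)// (le_trans g0 gB).
  have ? := rho0; have /andP[? ?] : lastc a - rho <= lastc z <= lastc a + rho.
    by rewrite !lastE mxE.
  by apply: powR_doubling; [lra|apply/andP; split; lra].
rewrite mulr0; suff -> : gradnorm bumpn z = 0 by rewrite powR0 ?mul0r// gt_eqF.
rewrite /gradnorm big1 ?sqrtr0// => j _; rewrite derive_bumpn.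
rewrite (@tensor_scaled_eq0 _ _ i) ?expr0n// mxE leNgt; apply/negP => /ltW H; apply: Hi.
by rewrite -ler_distl.
Qed.

End ScaledBump.

(** * From almost every pair to every pair, and bounds on $\Theta^0$ *)

Section Pointwise.
Variables (R : realType) (n : nat).
Implicit Types (x y : 'rV[R]_n).

Lemma open_halfspace : (0 < n)%N -> open (@halfspace R n).
Proof.
move=> n0; have [i lastE] := lastc_coord R n n0.
have -> : @halfspace R n = (fun x : 'rV[R]_n => x ord0 i) @^-1` [set t : R | 0 < t].
  by apply/seteqP; split => x; rewrite /halfspace/= lastE.
apply: open_comp; last exact: open_gt.
by move=> x _; exact: coord_continuous.
Qed.

(* The exceptional set would contain a small cube around [(x, y)]. *)
Lemma ae_pair_half_near (P : 'rV[R]_n -> 'rV[R]_n -> Prop) x y :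
  ae_pair_half P ->
  ~ (\forall q \near (x, y), halfspace n q.1 /\ halfspace n q.2 /\ ~ P q.1 q.2).
Proof.
move=> aeP /nbhs_ballP[e /= e0 He].
pose c := row_mx x y.
apply: (@box_not_null R (n + n) (\row_i (c ord0 i - e / 2)) (\row_i (c ord0 i + e / 2)) _ _ _ aeP).
  by move=> i; rewrite !mxE; lra.
move=> z /= Hz.
have close i : ball (c ord0 i) e (z ord0 i).
  rewrite /ball/= distrC ltr_distl; have := Hz i; rewrite !mxE => /andP[? ?].
  by apply/andP; split; lra.
apply: (He (lsubmx z, rsubmx z)); split; split=> //= i j; rewrite ord1 mxE.
  by have := close (lshift n j); rewrite /c row_mxEl.
by have := close (rshift n j); rewrite /c row_mxEr.
Qed.

(** By continuity, a strict violation at $(x,y)$ would persist on a neighbourhood, against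
    [ae_pair_half_near]. The real bound [e] replaces [E] so that the right-hand side is a continuous
    real function. *)
Lemma ae_pair_half_pointwise (omega : 'rV[R]_n -> 'rV[R]_n -> R) (u : 'rV[R]_n -> R)
    (E : \bar R) (e : R) x y :
  (0 < n)%N ->
  {within halfspace n `*` halfspace n, continuous (fun q => omega q.1 q.2)} ->
  (forall x y, halfspace n x -> halfspace n y -> 0 <= omega x y) ->
  continuous u -> (E <= e%:E)%E ->
  ae_pair_half (fun x y => ((`|u x - u y|)%:E <= (omega x y)%:E * E)%E) ->
  halfspace n x -> halfspace n y -> `|u x - u y| <= omega x y * e.
Proof.
move=> n0 cw w0 cu Ee ae hx hy; rewrite leNgt; apply/negP => lt_u.
have oH := open_halfspace n0.
have oHH : open (@halfspace R n `*` @halfspace R n).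
  have -> : @halfspace R n `*` @halfspace R n =
      (fst @^-1` @halfspace R n) `&` (snd @^-1` @halfspace R n) by [].
  by apply: openI; apply: open_comp => // q _; [exact: cvg_fst|exact: cvg_snd].
have cwxy : {for (x, y), continuous (fun q => omega q.1 q.2)}.
  move: cw; rewrite continuous_open_subspace// => cw; apply: cw.
  by rewrite inE.
apply: (@ae_pair_half_near _ x y ae).
have nH : \forall q \near (x, y), (halfspace n `*` halfspace n) q.
  by apply: open_nbhs_nbhs; split.
have cu1 : u q.1 @[q --> (x, y)] --> u x.
  by apply: (@cvg_comp _ _ _ fst u _ (nbhs x)); [exact: cvg_fst|exact: cu].
have cu2 : u q.2 @[q --> (x, y)] --> u y.
  by apply: (@cvg_comp _ _ _ snd u _ (nbhs y)); [exact: cvg_snd|exact: cu].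
have cd : `|u q.1 - u q.2| - omega q.1 q.2 * e @[q --> (x, y)] -->
    `|u x - u y| - omega x y * e.
  apply: cvgB; first by apply: cvg_norm; exact: cvgB.
  by apply: cvgM; [exact: cwxy|exact: cvg_cst].
have nd : \forall q \near (x, y), 0 < `|u q.1 - u q.2| - omega q.1 q.2 * e.
  by apply: (cvgr_gt _ cd); rewrite subr_gt0.
near=> q.
have [h1 h2] : (halfspace n `*` halfspace n) q by near: q.
split=> //; split=> //; apply/negP; rewrite -ltNge.
apply: (@le_lt_trans _ _ ((omega q.1 q.2)%:E * e%:E)%E).
  by rewrite lee_wpmul2l// lee_fin w0.
by rewrite -EFinM lte_fin -subr_gt0; near: q.
Unshelve. all: by end_near. Qed.

Lemma enorm_sub_sym x y : enorm (x - y) = enorm (y - x).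
Proof.
by rewrite /enorm; congr Num.sqrt; apply: eq_bigr => i _; rewrite !mxE -sqrrN opprB.
Qed.

(** If every coordinate is at most $r$ in absolute value, the norm is at most $\sqrt n\, r \le
    nr$. *)
Lemma enorm_far (r : R) x : (0 < n)%N -> 0 <= r -> r * n%:R < enorm x ->
  exists i, r < `|x ord0 i|.
Proof.
move=> n0 r0; apply: contraPP => /forallNP H; apply/negP; rewrite -leNgt.
have rn0 : 0 <= r * n%:R by rewrite mulr_ge0.
rewrite /enorm -(ger0_norm rn0) -sqrtr_sqr ler_wsqrtr// exprMn.
apply: (@le_trans _ _ (\sum_(i < n) r ^+ 2)).
  apply: ler_sum => i _; rewrite -(real_normK (num_real (x ord0 i))).
  by rewrite lerXn2r ?nnegrE// leNgt; apply/negP.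
rewrite sumr_const card_ord -[leLHS]mulr_natr ler_wpM2l ?sqr_ge0//.
by rewrite -natrX ler_nat; case: (n) n0 => // m _; rewrite expnS expn1 leq_pmulr.
Qed.

Lemma Theta0_le (beta kappa a : R) x y :
  0 < beta -> halfspace n x -> halfspace n y -> 0 < enorm (x - y) ->
  a = (if kappa < 0 then Num.min (lastc x) (lastc y)
       else Num.max (lastc x) (lastc y)) ->
  Theta0 beta kappa x y <= a `^ kappa * (Num.min (enorm (x - y)) a / a) `^ beta.
Proof.
move=> beta0 hx hy d0 aE; rewrite /Theta0.
have s0 : 0 < lastc x := hx; have t0 : 0 < lastc y := hy.
move: d0 s0 t0 aE; move: (enorm _) (lastc x) (lastc y) => d s t d0 s0 t0 aE.
set M := Num.max (Num.max s t) d.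
have dM : d <= M by rewrite le_max lexx orbT.
have stM : Num.max s t <= M by rewrite le_max lexx.
have a0 : 0 < a by rewrite aE; case: ifP => _; rewrite ?lt_min ?lt_max s0 t0.
have aM : a <= M.
  rewrite aE; case: ifP => _ //.
  by rewrite (le_trans _ stM)// ge_min le_max lexx.
have M0 : 0 < M by exact: lt_le_trans aM.
(* With [a] the selected height, both branches take the single form $a^\kappa (d/M)^\beta$. *)
have -> : (if kappa < 0 then d `^ beta / (Num.min s t `^ (- kappa) * M `^ beta)
    else Num.max s t `^ kappa * d `^ beta / M `^ beta) = a `^ kappa * (d / M) `^ beta.
  rewrite powRM ?invr_ge0 ?(ltW d0) ?(ltW M0)//.
  have -> : M^-1 `^ beta = (M `^ beta)^-1.
    by rewrite -(powR_inv1 (ltW M0)) -powRrM mulN1r powRN.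
  rewrite aE; case: ifP => _; last by rewrite mulrA.
  by rewrite powRN invfM invrK mulrCA.
rewrite ler_wpM2l ?powR_ge0//; apply: ge0_ler_powR; rewrite ?nnegrE ?(ltW beta0)//.
- by rewrite divr_ge0 ?(ltW d0) ?(ltW M0).
- by rewrite divr_ge0 ?(ltW a0)// le_min !ltW.
(* What remains is $da \le \min(d,a)M$: use $a \le M$ when the minimum is $d$, and $d \le M$ when it
   is $a$. *)
rewrite ler_pdivrMr// mulrAC ler_pdivlMr//.
rewrite minEle; case: ifP => _; first by rewrite ler_wpM2l ?(ltW d0).
by rewrite mulrC ler_wpM2l ?(ltW a0).
Qed.

Lemma Theta0_eq0 (beta kappa : R) x y : 0 < beta -> enorm (x - y) = 0 ->
  Theta0 beta kappa x y = 0.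
Proof.
by move=> b0 d0; rewrite /Theta0 d0 powR0 ?gt_eqF// mulr0 !mul0r if_same.
Qed.

End Pointwise.

(** * Homogeneity in [r] and [a] *)

Lemma powR_scale_cancel (R : realType) (n : nat) (gamma p a r : R) :
  0 < p -> 0 < a -> 0 < r ->
  a `^ (1 - (n%:R + gamma) / p) * (r / a) `^ (1 - n%:R / p) *
    (r^-1 * r `^ (n%:R / p) * a `^ (gamma / p)) = 1.
Proof.
move=> p0 a0 r0; have -> : r^-1 = r `^ (-1) by rewrite powR_inv1 ?ltW.
rewrite /powR !gt_eqF ?divr_gt0// ln_div ?posrE// -!expRD -[RHS]expR0.
(* The exponents of [r] are $\beta - 1 + n/p = 0$, those of [a] are $\kappa - \beta + \gamma/p =
   0$. *)
by congr expR; field; rewrite gt_eqF.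
Qed.

(** Identifies the $p$-th root of the energy bound, in the product form that [powR_scale_cancel]
    cancels. *)
Lemma powR_energy (R : realType) (n : nat) (gamma p a r c : R) :
  0 < p -> 0 < a -> 0 < r -> 0 <= c ->
  (c * (2 `^ `|gamma|) `^ p^-1 * (r^-1 * r `^ (n%:R / p) * a `^ (gamma / p))) `^ p =
  (c / r) `^ p * (2 `^ `|gamma| * a `^ gamma) * r ^+ n.
Proof.
move=> p0 a0 r0 c0; have pE : p != 0 by rewrite gt_eqF.
have ri : 0 <= r^-1 by rewrite invr_ge0 ltW.
have -> : c * (2 `^ `|gamma|) `^ p^-1 * (r^-1 * r `^ (n%:R / p) * a `^ (gamma / p)) =
  c / r * ((2 `^ `|gamma|) `^ p^-1 * a `^ (gamma / p)) * r `^ (n%:R / p) by ring.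
have c_r : 0 <= c / r by exact: mulr_ge0.
rewrite powRM ?mulr_ge0 ?powR_ge0// powRM ?mulr_ge0 ?powR_ge0//.
rewrite [((2 `^ `|gamma|) `^ p^-1 * _) `^ p]powRM ?powR_ge0//.
rewrite -!powRrM.
by rewrite mulVf// mulr1 !divfK// powR_mulrn// ltW.
Qed.

(** * Testing the inequality on the scaled bump *)

Theorem theorem1p5 (R : realType) (n : nat) (gamma p : R) :
  (2 <= n)%N -> n%:R < p ->
  exists C : R, 0 < C /\
    forall omega : 'rV[R]_n -> 'rV[R]_n -> R,
      {within halfspace n `*` halfspace n, continuous (fun q => omega q.1 q.2)} ->
      (forall x y, halfspace n x -> halfspace n y -> 0 <= omega x y) ->
      (forall u : 'rV[R]_n -> R, Cc_inf_half u ->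
         ae_pair_half (fun x y =>
           ((`|u x - u y|)%:E <= (omega x y)%:E * (weighted_energy p gamma u `^ p^-1))%E)) ->
      forall x y, halfspace n x -> halfspace n y ->
        C * Theta0 (1 - n%:R / p) (1 - (n%:R + gamma) / p) x y <= omega x y.
Proof.
move=> n2 np; have n0 : (0 < n)%N by exact: ltn_trans n2.
have nR0 : 0 < n%:R :> R by rewrite ltr0n.
have p0 : 0 < p by exact: lt_trans np.
set beta := 1 - n%:R / p; set kappa := 1 - (n%:R + gamma) / p.
have beta0 : 0 < beta by rewrite subr_gt0 ltr_pdivrMr// mul1r.
have [F [dF F_supp F00 F_bd]] := exists_bump R.
have [[B0 FB0] [B1 FB1]] := (F_bd 0%N, F_bd 1%N).
pose B := Num.max 1 (Num.max B0 B1).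
have Bge1 : 1 <= B by rewrite le_max lexx.
have F0B t : `|F 0 t| <= B by rewrite (le_trans (FB0 t))// !le_max lexx orbT.
have F1B t : `|F 1 t| <= B by rewrite (le_trans (FB1 t))// !le_max lexx !orbT.
have Bn0 : 0 < B ^+ n by rewrite exprn_gt0// (lt_le_trans ltr01).
(* Chosen so that the gradient bound $nB^n/\rho$ equals $c/r$ when $\rho = r/(2n)$. *)
pose c := 2 * n%:R ^+ 2 * B ^+ n.
have c0 : 0 < c by rewrite /c mulr_gt0// mulr_gt0// exprn_gt0.
pose K := c * (2 `^ `|gamma|) `^ p^-1.
have K0 : 0 < K by rewrite mulr_gt0// !powR_gt0.
(* The height of the bump divided by the constant in the $p$-th root of its energy bound. *)
exists (F 0%N 0 ^+ n / K); split; first by rewrite divr_gt0 ?exprn_gt0.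
move=> omega cw w0 Hw x y hx hy.
have [d0|d_neq0] := eqVneq (enorm (x - y)) 0.
  by rewrite Theta0_eq0// mulr0 w0.
have d0 : 0 < enorm (x - y) by rewrite lt_neqAle eq_sym d_neq0 sqrtr_ge0.
(* [a] is the centre and [b] the other point; the data are symmetric, so either order of [x] and [y]
   is allowed. *)
suff main (a b : 'rV[R]_n) : halfspace n a -> enorm (a - b) = enorm (x - y) ->
    (forall u : 'rV[R]_n -> R, `|u x - u y| = `|u a - u b|) ->
    lastc a = (if kappa < 0 then Num.min (lastc x) (lastc y)
               else Num.max (lastc x) (lastc y)) ->
    F 0%N 0 ^+ n / K * Theta0 beta kappa x y <= omega x y.
  have sym : enorm (y - x) = enorm (x - y) by rewrite enorm_sub_sym.
  have symu (u : 'rV[R]_n -> R) : `|u x - u y| = `|u y - u x| by rewrite distrC.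
  case: (ltP kappa 0) main => k0 main; have [xy|yx] := leP (lastc x) (lastc y).
  - by apply: (main x y) => //; rewrite min_l.
  - by apply: (main y x) => //; rewrite min_r// ltW.
  - by apply: (main y x) => //; rewrite max_r.
  - by apply: (main x y) => //; rewrite max_l// ltW.
move=> ha dab uab aE; have a0 : 0 < lastc a := ha.
pose r := Num.min (enorm (x - y)) (lastc a).
have r0 : 0 < r by rewrite lt_min d0.
pose rho := r / (2 * n%:R).
have rho0 : 0 < rho by rewrite divr_gt0 ?mulr_gt0.
have rho_a : rho <= lastc a / 2.
  rewrite /rho ler_pdivrMr ?mulr_gt0// mulrA divfK ?pnatr_eq0//.
  have ra : r <= lastc a by rewrite ge_min lexx orbT.
  by rewrite (le_trans ra)// ler_peMr ?ler1n// ltW.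
pose u := bumpn R F n a rho.
have Cu : Cc_inf_half u by exact: Cc_inf_half_bumpn.
pose e := K * (r^-1 * r `^ (n%:R / p) * lastc a `^ (gamma / p)).
have e0 : 0 < e by rewrite !mulr_gt0 ?invr_gt0 ?powR_gt0.
have E_e : (weighted_energy p gamma u `^ p^-1 <= e%:E)%E.
  have Ee : (weighted_energy p gamma u <= (e `^ p)%:E)%E.
    have := weighted_energy_bumpn _ _ _ dF F_supp Bge1 F0B F1B _ a _ rho0 p gamma.
    move=> /(_ n0 p0 rho_a)/le_trans; apply.
    rewrite lee_fin /e /K powR_energy ?(ltW c0)//.
    have -> : n%:R * (B ^+ n / rho) = c / r.
      by rewrite /rho /c; field; rewrite !gt_eqF.
    rewrite ler_wpM2l ?mulr_ge0 ?powR_ge0//.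
    rewrite lerXn2r ?nnegrE ?mulr_ge0 ?(ltW rho0) ?(ltW r0)//.
    (* Hence $(2\rho)^n \le r^n$, as $n \ge 1$. *)
    have -> : 2 * rho = r / n%:R by rewrite /rho; field; rewrite !gt_eqF.
    by rewrite ler_pdivrMr// ler_peMr ?(ltW r0)// ler1n.
  have -> : e%:E = ((e `^ p)%:E `^ p^-1)%E.
    by rewrite poweR_EFin -powRrM mulfV ?gt_eqF// powRr1// ltW.
  have E_ge0 : (0 <= weighted_energy p gamma u)%E.
    by apply: iint_ge0 => s; case: ifP => // _; rewrite lee_fin mulr_ge0 ?powR_ge0.
  apply: gt0_ler_poweR; rewrite // ?invr_ge0 ?(ltW p0)// in_itv/= leey andbT//.
  by rewrite lee_fin powR_ge0.
have := ae_pair_half_pointwise _ _ omega u _ e x y n0 cw w0 (proj1 (Cu.1 [::])) E_e (Hw u Cu) hx hy.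
rewrite uab; have -> : u a = F 0%N 0 ^+ n by exact: bumpn_center.
(* Since $n\rho = r/2 < |a-b|$, some coordinate of [b] leaves the cube, so the bump vanishes at
   [b]. *)
have [i far] : exists i, rho < `|(b - a) ord0 i|.
  apply: enorm_far => //; first exact: ltW.
  rewrite enorm_sub_sym dab /rho invfM mulrA divfK ?gt_eqF//.
  have : r <= enorm (x - y) by rewrite ge_min lexx.
  lra.
have -> : u b = 0.
  by apply: (@tensor_scaled_eq0 R F F_supp n a rho rho0 _ b i); move: far; rewrite !mxE => /ltW.
rewrite subr0 ger0_norm ?exprn_ge0 ?(ltW F00)// => bump_le.
have T_le := Theta0_le _ _ _ _ _ _ _ beta0 hx hy d0 aE.
set T := _ * _ `^ beta in T_le.
(* By the cancellation of exponents, the bound [T] for $\Theta^0$ is $K/e$, so the constant times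
   [T] is the height over [e], which [bump_le] bounds by [omega x y]. *)
have Te : T * e = K by rewrite /e mulrCA /T powR_scale_cancel// mulr1.
apply: (@le_trans _ _ (F 0%N 0 ^+ n / K * T)).
  by rewrite ler_wpM2l// divr_ge0 ?exprn_ge0 ?ltW.
have -> : T = K / e by rewrite -Te mulfK// gt_eqF.
by rewrite mulrA divfK ?gt_eqF// ler_pdivrMr.
Qed.
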